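(* Over $(M_3,\mathrm{tr})$ let $G_4$ be the operator $G_4(e_{ii})=\tfrac32\sum_{j\neq i}e_{jj}$, $G_4(e_{ij})=\tfrac32e_{ji}$ for $i\ne j$. Then $G_4$ is an irreflexive real undirected strongly regular quantum graph with $\mu=\tfrac34\neq0$, both $G_4$ and its complement $G_6=J-\mathrm{id}-G_4$ are connected, and neither $G_4$ nor $G_6$ is quantum isomorphic to a classical graph.
   Context: Finite quantum sets. A finite quantum set $X$ is a finite-dimensional C*-algebra $A$ with a faithful state $\psi$; $\ell^2(X)$ denotes $A$ with inner product $\langle a,b\rangle=\psi(a^*b)$, $m$ the multiplication, $\iota:\mathbb C\to\ell^2(X)$ the unit map, $m^\dagger,\iota^\dagger$ their adjoints, and it is required that $m m^\dagger=\delta^2\,\mathrm{id}$ for some $\delta>0$. For $(M_3,\mathrm{tr})$ with normalized trace, $\delta^2=9$; $e_{ij}$ are the matrix units. Put $\mathrm{ev}_X=\iota^\dagger m$, $\mathrm{coev}_X=m^\dagger\iota$, $J=\delta^2\iota\iota^\dagger$. A classical set with $N$ points is $\mathbb C^N$ with normalized trace. Quantum graphs. On $\mathrm{End}(\ell^2(X))$ put $S\star T=\delta^{-2}m(S\otimes T)m^\dagger$ and $T^*=(\mathrm{ev}_X\otimes\mathrm{id})(\mathrm{id}\otimes T^\dagger\otimes\mathrm{id})(\mathrm{id}\otimes\mathrm{coev}_X)$. A quantum graph $(X,\hat T)$ is an operator with $\hat T\star\hat T=\hat T$; irreflexive if $\hat T\star\mathrm{id}=0=\mathrm{id}\star\hat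 T$, real if $\hat T^*=\hat T$, undirected if $\hat T^\dagger=\hat T$. A classical graph is a quantum graph over some classical set. The complement of an irreflexive graph is $\hat T^c=J-\mathrm{id}-\hat T$. Strongly regular with parameters $(k,\lambda,\mu)$: $\hat T^2=\lambda\hat T+\mu\hat T^c+k\,\mathrm{id}$. With $L(\hat T)=(\iota^\dagger\otimes\mathrm{id})(\hat T\otimes\mathrm{id})m^\dagger-\hat T$, connected means $\dim\ker L(\hat T)=1$. Quantum isomorphisms. $(X,\hat T)$ and $(X',\hat T')$ are quantum isomorphic if there are a finite-dimensional Hilbert space $H\ne0$ and a linear map $P:H\otimes\ell^2(X)\to\ell^2(X')\otimes H$ with $(m_{X'}^\dagger\otimes\mathrm{id})P=(\mathrm{id}\otimes P)(P\otimes\mathrm{id})(\mathrm{id}_H\otimes m_X^\dagger)$, $(\iota_{X'}^\dagger\otimes\mathrm{id}_H)P=\mathrm{id}_H\otimes\iota_X^\dagger$, $P^\dagger=(\mathrm{ev}_{X'}\otimes\mathrm{id}_H\otimes\mathrm{id}_X)(\mathrm{id}_{X'}\otimes P\otimes\mathrm{id}_X)(\mathrm{id}_{X'}\otimes\mathrm{id}_H\otimes\mathrm{coev}_X)$, $P(\mathrm{id}_H\otimes m_X)=(m_{X'}\otimes\mathrm{id}_H)(\mathrm{id}\otimes P)(P\otimes\mathrm{id})$, $P(\mathrm{id}_H\otimes\iota_X)=\iota_{X'}\otimes\mathrm{id}_H$ and $P(\mathrm{id}_H\otimes\hat T)=(\hat T'\otimes\mathrm{id}_H)P$. *)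

(* Defs.v *)
From HB Require Import structures.
From mathcomp Require Import all_boot all_order all_algebra all_field.
From mathcomp Require Import all_real_closed.
From mathcomp Require Import classical_sets reals.

Set Implicit Arguments.
Unset Strict Implicit.
Unset Printing Implicit Defensive.

Import Order.TTheory GRing.Theory Num.Theory.
Local Open Scope complex_scope.
Local Open Scope sesquilinear_scope.
Local Open Scope ring_scope.

(* The Kronecker product of matrices: the tensor product of linear maps between
   the spaces C^n, with C^m (x) C^n identified with C^(m * n). *)
Notation "A *t B" := (tensmx A B)
  (at level 40, left associativity, format "A  *t  B") : ring_scope.

(* The complex numbers are R[i] for a model R : realType of the real numbers.
   [M ^t*] is the conjugate transpose. *)

Lemma sum_tens (V : nmodType) m n (F : 'I_(m * n) -> V) :
  \sum_k F k = \sum_i \sum_j F (mxtens_index (i, j)).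
Proof.
rewrite pair_bigA /= (reindex (@mxtens_index m n)) /=.
  by apply: eq_bigr => -[].
exists (@mxtens_unindex _ _) => x _; by rewrite (mxtens_indexK, mxtens_unindexK).
Qed.

(** * Finite-dimensional C*-algebras *)

(* No completeness clause: it is automatic in finite dimension. *)
Definition is_cstar_norm (R : realType) (A : falgType R[i]) (star : A -> A)
    (N : A -> R) : Prop :=
  [/\ (forall a, N a = 0 -> a = 0) /\ (forall a, 0 <= N a),
      forall a b, N (a + b) <= N a + N b,
      forall (z : R[i]) a, (N (z *: a))%:C = `|z| * (N a)%:C,
      forall a b, N (a * b) <= N a * N b &
      forall a, N (star a * a) = N a ^+ 2].

(* The norm is not part of the data, since a *-algebra has at most one
   C*-norm. *)
Record cstarAlg (R : realType) := CstarAlg {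
  cstar_sort :> falgType R[i];
  star : cstar_sort -> cstar_sort;
  star_semilinear :
    forall (z : R[i]) a b, star (z *: a + b) = z^* *: star a + star b;
  starM : forall a b, star (a * b) = star b * star a;
  starK : forall a, star (star a) = a;
  cstar_norm_ex : exists N, is_cstar_norm star N }.

(** * Finite quantum sets *)

(* A finite-dimensional C*-algebra with a faithful state psi.  Linear maps
   between tensor powers of l^2(X) are represented by matrices, acting on
   columns, with respect to an orthonormal basis [onb] of l^2(X) for
   <a, b> = psi (a^* b); every notion below is independent of its choice. *)
Record statedAlg (R : realType) := StatedAlg {
  stated_alg :> cstarAlg R;
  psi : {scalar stated_alg};
  psi_ge0 : forall a, 0 <= psi (star a * a);
  psi1 : psi 1 = 1;
  psi_faithful : forall a, psi (star a * a) = 0 -> a = 0;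
  qdim : nat;
  onb : 'I_qdim -> stated_alg;
  onb_ortho : forall i j, psi (star (onb i) * onb j) = (i == j)%:R;
  onb_gen : forall a, a = \sum_i psi (star (onb i) * a) *: onb i }.

Section Structure.
Variables (R : realType) (X : statedAlg R).
Local Notation C := R[i].
Local Notation n := (qdim X).

Definition ip (a b : X) : C := psi X (star a * b).

Definition qcoord (a : X) : 'cV[C]_n := \col_i ip (onb i) a.

Definition opmx (f : {linear X -> X}) : 'M[C]_n :=
  \matrix_(i, j) ip (onb i) (f (onb j)).

Definition qmul : 'M[C]_(n, n * n) :=
  \matrix_(i, jk) ip (onb i)
    (onb (mxtens_unindex jk).1 * onb (mxtens_unindex jk).2).

Definition qunit : 'M[C]_(n, 1) := qcoord 1.

Definition qev : 'M[C]_(1, n * n) := qunit ^t* *m qmul.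
Definition qcoev : 'M[C]_(n * n, 1) := qmul ^t* *m qunit.

Lemma ip_linear a : scalar (ip a).
Proof. by move=> z b c; rewrite /ip mulrDr -scalerAr linearP. Qed.
HB.instance Definition _ a :=
  GRing.isLinear.Build C X C *%R (ip a) (ip_linear a).

Lemma qcoord_opmx (f : {linear X -> X}) a :
  qcoord (f a) = opmx f *m qcoord a.
Proof.
apply/colP => i; rewrite !mxE {1}[a]onb_gen !linear_sum.
by apply: eq_bigr => j _; rewrite !linearZ !mxE mulrC.
Qed.

Lemma qcoordM a b : qcoord (a * b) = qmul *m (qcoord a *t qcoord b).
Proof.
apply/colP => i; rewrite !mxE sum_tens {1}[a]onb_gen {1}[b]onb_gen.
rewrite mulr_suml linear_sum; apply: eq_bigr => j _.
rewrite mulr_sumr linear_sum; apply: eq_bigr => k _.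
rewrite -scalerAl -scalerAr scalerA linearZ !mxE !mxtens_indexK /=.
by rewrite mulrC.
Qed.

End Structure.

Arguments qmul {R} X.
Arguments qunit {R} X.
Arguments qev {R} X.
Arguments qcoev {R} X.

Record qset (R : realType) := Qset {
  qset_alg :> statedAlg R;
  delta : R;
  delta_gt0 : 0 < delta;
  qmul_special : qmul qset_alg *m (qmul qset_alg) ^t* = (delta ^+ 2)%:C%:M }.

(** * Coherence isomorphisms of the tensor product *)

Section Coherence.
Variable C : nzRingType.

(* (A (x) B) (x) D -> A (x) (B (x) D) and its inverse *)
Definition assoc (a b d : nat) : 'M[C]_(a * (b * d), a * b * d) :=
  castmx (esym (mulnA a b d), erefl _) 1%:M.
Definition assocV (a b d : nat) : 'M[C]_(a * b * d, a * (b * d)) :=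
  castmx (mulnA a b d, erefl _) 1%:M.

(* C (x) A -> A and A (x) C -> A, and their inverses *)
Definition lunit (a : nat) : 'M[C]_(a, 1 * a) :=
  castmx (mul1n a, erefl _) 1%:M.
Definition lunitV (a : nat) : 'M[C]_(1 * a, a) :=
  castmx (esym (mul1n a), erefl _) 1%:M.
Definition runit (a : nat) : 'M[C]_(a, a * 1) :=
  castmx (muln1 a, erefl _) 1%:M.
Definition runitV (a : nat) : 'M[C]_(a * 1, a) :=
  castmx (esym (muln1 a), erefl _) 1%:M.

Lemma castmx1_mul m m' p (e : m = m') (M : 'M[C]_(m, p)) :
  castmx (e, erefl m) 1%:M *m M = castmx (e, erefl p) M.
Proof. by case: m' / e; rewrite !castmx_id mul1mx. Qed.

Lemma assoc_tens a b d (u : 'cV[C]_a) (v : 'cV[C]_b) (w : 'cV[C]_d) :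
  assoc a b d *m (u *t v *t w) = u *t (v *t w).
Proof.
apply/colP => k; rewrite castmx1_mul castmxE.
have [i jl] := mxtens_indexP k; have [j l] := mxtens_indexP jl.
have -> : cast_ord (esym (esym (mulnA a b d)))
            (mxtens_index (i, mxtens_index (j, l)))
          = mxtens_index (mxtens_index (i, j), l).
  by apply: val_inj; rewrite /= mulnDl mulnA addnA.
rewrite !(mxE, mxtens_indexK) /= mulrA.
by congr (u _ _ * v _ _ * w _ _); rewrite [LHS]ord1 [RHS]ord1.
Qed.

Lemma lunit_tens a (z : 'cV[C]_1) (u : 'cV[C]_a) :
  lunit a *m (z *t u) = z 0 0 *: u.
Proof.
apply/colP => k; rewrite castmx1_mul castmxE.
have -> : cast_ord (esym (mul1n a)) k = mxtens_index (0 : 'I_1, k).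
  by apply: val_inj.
rewrite !mxE !mxtens_indexK /=.
by congr (z _ _ * u _ _); exact: val_inj.
Qed.

End Coherence.

Arguments assoc {C} a b d.
Arguments assocV {C} a b d.
Arguments lunit {C} a.
Arguments lunitV {C} a.
Arguments runit {C} a.
Arguments runitV {C} a.

(** * Quantum graphs *)

Section Graphs.
Variables (R : realType) (X : qset R).
Local Notation C := R[i].
Local Notation n := (qdim X).
Local Notation m := (qmul X).
Local Notation iota := (qunit X).
Local Notation delta2 := ((delta X ^+ 2)%:C).
Implicit Types S T : 'M[C]_n.

Definition schur S T : 'M[C]_n := delta2^-1 *: (m *m (S *t T) *m m ^t*).

Definition opstar T : 'M[C]_n :=
  lunit n *m (qev X *t 1%:M) *m assocV n n n *m (1%:M *t (T ^t* *t 1%:M))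
    *m (1%:M *t qcoev X) *m runitV n.

Definition Jop : 'M[C]_n := delta2 *: (iota *m iota ^t*).

Definition quantum_graph T : Prop := schur T T = T.
Definition irreflexive_graph T : Prop :=
  schur T 1%:M = 0 /\ schur 1%:M T = 0.
Definition real_graph T : Prop := opstar T = T.
Definition undirected_graph T : Prop := T ^t* = T.

Definition graph_compl T : 'M[C]_n := Jop - 1%:M - T.

Definition strongly_regular T (k lambda mu : C) : Prop :=
  T *m T = lambda *: T + mu *: graph_compl T + k *: 1%:M.

Definition laplacian T : 'M[C]_n :=
  lunit n *m (iota ^t* *t 1%:M) *m (T *t 1%:M) *m m ^t* - T.

(* The column space of [cokermx L] is {v | L *m v = 0}. *)
Definition connected_graph T : Prop := \rank (cokermx (laplacian T)) = 1%N.

End Graphs.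

(** * Quantum isomorphisms *)

Section Isomorphism.
Variables (R : realType) (X X' : qset R).
Local Notation C := R[i].
Local Notation n := (qdim X).
Local Notation n' := (qdim X').

(* P : H (x) l^2(X) -> l^2(X') (x) H, with H = C^d *)
Definition is_qiso (T : 'M[C]_n) (T' : 'M[C]_n') (d : nat)
    (P : 'M[C]_(n' * d, d * n)) : Prop :=
  let idH : 'M[C]_d := 1%:M in
  let idX : 'M[C]_n := 1%:M in
  let idX' : 'M[C]_n' := 1%:M in
  (* H (x) X (x) X -> X' (x) X' (x) H *)
  let PP : 'M[C]_(n' * n' * d, d * (n * n)) :=
    assocV n' n' d *m (idX' *t P) *m assoc n' d n *m (P *t idX)
      *m assocV d n n in
  [/\ ((qmul X') ^t* *t idH) *m P = PP *m (idH *t (qmul X) ^t*),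
      lunit d *m ((qunit X') ^t* *t idH) *m P
        = runit d *m (idH *t (qunit X) ^t*),
      P ^t* =
        lunit (d * n) *m (qev X' *t (idH *t idX)) *m assoc (n' * n') d n
          *m (assocV n' n' d *t idX) *m (idX' *t P *t idX)
          *m (assoc n' d n *t idX) *m assocV (n' * d) n n
          *m (idX' *t idH *t qcoev X) *m runitV (n' * d),
      P *m (idH *t qmul X) = (qmul X' *t idH) *m PP &
      P *m (idH *t qunit X) *m runitV d = (qunit X' *t idH) *m lunitV d] /\
  P *m (idH *t T) = (T' *t idH) *m P.

(* A nonzero finite-dimensional Hilbert space H is some C^d with 0 < d. *)
Definition quantum_isomorphic (T : 'M[C]_n) (T' : 'M[C]_n') : Prop :=
  exists (d : nat) (P : 'M[C]_(n' * d, d * n)), (0 < d)%N /\ is_qiso T T' P.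

End Isomorphism.

(** * The quantum sets (M_n, tr) and C^n *)

Lemma real_complexM (R : realType) (x y : R) : (x * y)%:C = x%:C * y%:C.
Proof. exact: rmorphM. Qed.
Lemma real_complexD (R : realType) (x y : R) : (x + y)%:C = x%:C + y%:C.
Proof. exact: rmorphD. Qed.

Section OpNorm.
Variables (R : realType) (n : nat).
Local Notation C := R[i].
Implicit Types (u : 'rV[C]_n) (M : 'M[C]_n).

Let hn (u : 'rV[C]_n) : C := sqrtC (dotmx u u).

Lemma hn_ge0 u : 0 <= hn u.
Proof. by rewrite sqrtC_ge0 dnorm_ge0. Qed.

Lemma hnK u : hn u ^+ 2 = dotmx u u.
Proof. exact: sqrtCK. Qed.

Lemma dotmx_ge0 u : 0 <= dotmx u u.
Proof. exact: dnorm_ge0. Qed.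

Lemma hn_real u : (complex.Re (hn u))%:C = hn u.
Proof. by apply: RRe_real; apply: ger0_real; apply: hn_ge0. Qed.

Lemma hn0 : hn 0 = 0.
Proof. by rewrite /hn linear0r sqrtC0. Qed.

Lemma hn_eq0 u : hn u = 0 -> u = 0.
Proof. by move/eqP; rewrite sqrtC_eq0 dnorm_eq0 => /eqP. Qed.

Lemma hnD u v : hn (u + v) <= hn u + hn v.
Proof. by have [] := triangle_lerif (@dotmx C n) u v. Qed.

Lemma hnZ (z : C) u : hn (z *: u) = `|z| * hn u.
Proof.
by rewrite /hn dnormZ rootCMl ?sqrtCK ?exprn_ge0 // sqrCK.
Qed.

Lemma hn_CS u v : `|dotmx u v| <= hn u * hn v.
Proof. by have [] := CauchySchwarz_sqrt (@dotmx C n) u v. Qed.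

Let opset M : set R :=
  [set r | exists u, hn u <= 1 /\ r%:C = hn (u *m M)]%classic.
(* The operator norm of n x n matrices, for the euclidean norm on row vectors. *)
Definition opn M : R := sup (opset M).

Lemma opset_has_sup M : has_sup (opset M).
Proof.
split; first by exists 0; exists 0; rewrite mul0mx hn0 ler01.
exists (complex.Re (\sum_i hn (row i M))) => r [u [u1 rE]].
rewrite -lecR RRe_real ?sum_real//; last first.
  by move=> i _; apply/ger0_real/hn_ge0.
rewrite rE mulmx_sum_row.
apply: (@le_trans _ _ (\sum_i hn (u 0 i *: row i M))).
  elim/big_ind2: _ => // [|x1 x2 y1 y2 h1 h2]; first by rewrite hn0.
  by apply: le_trans (hnD _ _) _; apply: lerD.
apply: ler_sum => i _; rewrite hnZ ler_piMl ?hn_ge0 //.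
have -> : u 0 i = dotmx u (delta_mx 0 i).
  rewrite dotmxE mxE (bigD1 i) //= !mxE !eqxx conjC1 mulr1 big1 ?addr0 //.
  by move=> j ji; rewrite !mxE eqxx (negPf ji) conjC0 mulr0.
apply: le_trans (hn_CS _ _) _.
suff -> : hn (delta_mx 0 i) = 1 by rewrite mulr1.
rewrite /hn dotmxE mxE (bigD1 i) //= !mxE !eqxx conjC1 mulr1 big1 ?addr0 ?sqrtC1 //.
by move=> j ji; rewrite !mxE eqxx (negPf ji) conjC0 mulr0.
Qed.

Lemma opn_ge0 M : 0 <= opn M.
Proof.
by apply: (ub_le_sup (opset_has_sup M).2); exists 0; rewrite mul0mx hn0 ler01.
Qed.

Lemma opnP M u : hn (u *m M) <= (opn M)%:C * hn u.
Proof.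
have [->|u0] := eqVneq u 0; first by rewrite mul0mx hn0 mulr0.
have hu : 0 < hn u.
  by rewrite lt_def hn_ge0 andbT; apply: contra u0 => /eqP/hn_eq0->.
rewrite -ler_pdivrMr // mulrC -(ger0_norm (_ : 0 <= (hn u)^-1)) ?invr_ge0 ?hn_ge0 //.
rewrite -hnZ scalemxAl -hn_real lecR.
apply: (ub_le_sup (opset_has_sup M).2); exists ((hn u)^-1 *: u); split.
  by rewrite hnZ ger0_norm ?invr_ge0 ?hn_ge0 // mulVf ?gt_eqF.
exact: hn_real.
Qed.

Lemma opn_le M (K : R) :
  0 <= K -> (forall u, hn (u *m M) <= K%:C * hn u) -> opn M <= K.
Proof.
move=> K0 HK; apply: ge_sup; first exact: (opset_has_sup M).1.
move=> r [u [u1 rE]]; rewrite -lecR rE; apply: le_trans (HK u) _.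
by rewrite ler_piMr // lecE /= eqxx.
Qed.

Lemma opnM M N : opn (M *m N) <= opn M * opn N.
Proof.
apply: opn_le; first by rewrite mulr_ge0 ?opn_ge0.
move=> u; rewrite mulmxA; apply: le_trans (opnP _ _) _.
have := opn_ge0 N; have := opn_ge0 M; have := opnP M u.
move: (opn M) (opn N) => x y h x0 y0; rewrite [x * y]mulrC real_complexM -mulrA.
by rewrite ler_wpM2l ?ler0c.
Qed.

Lemma opn_adj M : opn M ^+ 2 <= opn (M *m M ^t*).
Proof.
have := opn_ge0 (M *m M ^t*); have := opnP (M *m M ^t*).
move: (opn (M *m _)) => K KP K0.
suff : opn M <= Num.sqrt K.
  have := opn_ge0 M; move: (opn M) => x x0 xy.
  by rewrite -(sqr_sqrtr K0) lerXn2r ?nnegrE ?sqrtr_ge0.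
apply: opn_le; first exact: sqrtr_ge0.
move=> u; rewrite -(@ler_pXn2r _ 2) ?nnegrE ?hn_ge0 //; last first.
  by rewrite mulr_ge0 ?ler0c ?sqrtr_ge0 ?hn_ge0.
rewrite exprMn (_ : (Num.sqrt K)%:C ^+ 2 = K%:C); last first.
  by rewrite -[in RHS](sqr_sqrtr K0) !expr2 real_complexM.
have E : dotmx (u *m M) (u *m M) = dotmx (u *m (M *m M ^t*)) u.
  by rewrite !dotmxE trmx_mul map_mxM !mulmxA.
have Hq : hn (u *m M) ^+ 2 = `|dotmx (u *m (M *m M ^t*)) u|.
  rewrite hnK; apply: (etrans E); apply/esym/ger0_norm.
  by apply: le_trans (dotmx_ge0 (u *m M)) _; rewrite E.
rewrite [X in X <= _]Hq.
apply: le_trans (hn_CS _ _) _.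
by rewrite expr2 mulrA ler_wpM2r ?hn_ge0.
Qed.

Lemma opn_star M : opn (M ^t*) = opn M.
Proof.
suff H N : opn N <= opn (N ^t*).
  by apply/le_anti/andP; split; [rewrite -{2}[M]trmxCK; exact: H|exact: H].
have := le_trans (opn_adj N) (opnM _ _).
have := opn_ge0 N; have := opn_ge0 (N ^t*).
move: (opn N) (opn _) => x y y0; rewrite le_eqVlt => /orP[/eqP<- //|x0].
by rewrite expr2 ler_pM2l.
Qed.

Lemma opn_cstar M : opn (M ^t* *m M) = opn M ^+ 2.
Proof.
apply/le_anti/andP; split.
  by have := opnM (M ^t*) M; rewrite opn_star expr2.
by have := opn_adj (M ^t*); rewrite opn_star trmxCK.
Qed.

Lemma opnD M N : opn (M + N) <= opn M + opn N.
Proof.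
apply: opn_le; first by rewrite addr_ge0 ?opn_ge0.
move=> u; rewrite mulmxDr; apply: le_trans (hnD _ _) _.
have := opnP M u; have := opnP N u; move: (opn M) (opn N) => x y xP yP.
by rewrite real_complexD mulrDl lerD.
Qed.

Lemma opn_eq0 M : opn M = 0 -> M = 0.
Proof.
move=> M0; apply/row_matrixP => i; rewrite rowE row0; apply: hn_eq0.
apply/le_anti; rewrite hn_ge0 andbT.
by have := opnP M (delta_mx 0 i); rewrite M0 mul0r.
Qed.

Lemma opnZ_le (z : C) M : (opn (z *: M))%:C <= `|z| * (opn M)%:C.
Proof.
have zE : (complex.Re `|z|)%:C = `|z| by apply/RRe_real/normr_real.
have z0 : 0 <= complex.Re `|z| by rewrite -ler0c zE.
rewrite -zE -real_complexM lecR; apply: opn_le; first exact: mulr_ge0 (opn_ge0 M).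
move=> u; rewrite -scalemxAr hnZ real_complexM zE -mulrA.
have := opnP M u; move: (opn M) => x xP.
by rewrite ler_wpM2l.
Qed.

Lemma opnZ (z : C) M : (opn (z *: M))%:C = `|z| * (opn M)%:C.
Proof.
apply/le_anti; rewrite opnZ_le /=.
have [->|z0] := eqVneq z 0; first by rewrite normr0 mul0r ler0c opn_ge0.
have zp : 0 < `|z| by rewrite normr_gt0.
have := opnZ_le z^-1 (z *: M); rewrite scalerA mulVf // scale1r normfV.
move: (opn M) (opn _) => x y xy.
by rewrite mulrC -ler_pdivlMr // mulrC.
Qed.

End OpNorm.

Section MatrixAlgebra.
Variables (R : realType) (n : nat).
Local Notation C := R[i].
Local Notation A := 'M[C]_n.+1.

Definition mx_star (a : A) : A := a ^t*.

Lemma mx_star_semilinear (z : C) (a b : A) :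
  mx_star (z *: a + b) = z^* *: mx_star a + mx_star b.
Proof. by apply/matrixP => i j; rewrite !mxE rmorphD rmorphM. Qed.

Lemma mx_starM (a b : A) : mx_star (a * b) = mx_star b * mx_star a.
Proof. by rewrite /mx_star trmx_mul map_mxM. Qed.

Lemma mx_starK (a : A) : mx_star (mx_star a) = a.
Proof. exact: trmxCK. Qed.

Lemma mx_cstar_norm : exists N : A -> R, is_cstar_norm mx_star N.
Proof.
exists (@opn R n.+1); split; first by split; [exact: opn_eq0|exact: opn_ge0].
- exact: opnD.
- exact: opnZ.
- exact: opnM.
- exact: opn_cstar.
Qed.

Definition matrix_cstarAlg : cstarAlg R :=
  CstarAlg mx_star_semilinear mx_starM mx_starK mx_cstar_norm.

Definition mx_state (a : A) : C := \tr a / n.+1%:R.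

Lemma mx_state_linear : scalar mx_state.
Proof.
by move=> z a b; rewrite /mx_state linearP mulrDl /= mulrA.
Qed.
HB.instance Definition _ :=
  GRing.isLinear.Build C A C *%R mx_state mx_state_linear.

Lemma mx_stateE (a b : A) :
  mx_state (mx_star a * b) = (\sum_i \sum_j (a i j)^* * b i j) / n.+1%:R.
Proof.
rewrite exchange_big /=; congr (_ / _); apply: eq_bigr => j _.
by rewrite !mxE; apply: eq_bigr => i _; rewrite !mxE.
Qed.

Lemma mx_state_ge0 (a : A) : 0 <= mx_state (mx_star a * a).
Proof.
rewrite mx_stateE divr_ge0 ?ler0n // sumr_ge0 // => i _; rewrite sumr_ge0 //.
by move=> j _; rewrite mulrC mul_conjC_ge0.
Qed.

Lemma mx_state1 : mx_state 1 = 1.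
Proof. by rewrite /mx_state mxtrace1 divff // pnatr_eq0. Qed.

Lemma mx_state_faithful (a : A) : mx_state (mx_star a * a) = 0 -> a = 0.
Proof.
rewrite mx_stateE => /eqP; rewrite mulf_eq0 invr_eq0 pnatr_eq0 orbF.
rewrite psumr_eq0 => [/allP a0|i _]; last first.
  by rewrite sumr_ge0 // => j _; rewrite mulrC mul_conjC_ge0.
apply/matrixP => i j; have := a0 i (mem_index_enum _).
rewrite psumr_eq0 => [/allP/(_ j (mem_index_enum _))|k _]; last first.
  by rewrite mulrC mul_conjC_ge0.
by rewrite mulrC mul_conjC_eq0 mxE => /eqP.
Qed.

Definition mx_onb (k : 'I_(n.+1 * n.+1)) : A :=
  sqrtC n.+1%:R *: delta_mx (mxtens_unindex k).1 (mxtens_unindex k).2.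

Lemma mx_state_onb (a : A) k :
  mx_state (mx_star (mx_onb k) * a)
    = a (mxtens_unindex k).1 (mxtens_unindex k).2 / sqrtC n.+1%:R.
Proof.
rewrite mx_stateE (bigD1 (mxtens_unindex k).1) //= [X in (_ + X) / _]big1 => [|i ne]; last first.
  by rewrite big1 // => j _; rewrite !mxE (negPf ne) mulr0 conjC0 mul0r.
rewrite addr0 (bigD1 (mxtens_unindex k).2) //= [X in (_ + X) / _]big1 => [|j ne]; last first.
  by rewrite !mxE (negPf ne) andbF mulr0 conjC0 mul0r.
rewrite addr0 !mxE !eqxx mulr1 geC0_conj ?sqrtC_ge0 ?ler0n //.
rewrite -{2}[n.+1%:R]sqrtCK expr2 invfM mulrA [sqrtC _ * _]mulrC mulfK //.
by rewrite sqrtC_eq0 pnatr_eq0.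
Qed.

Lemma mx_onb_ortho i j :
  mx_state (mx_star (mx_onb i) * mx_onb j) = (i == j)%:R.
Proof.
rewrite mx_state_onb !mxE mulrC mulKf ?sqrtC_eq0 ?pnatr_eq0 //.
by rewrite -xpair_eqE -!surjective_pairing (can_eq (@mxtens_unindexK _ _)).
Qed.

Lemma mx_onb_gen (a : A) :
  a = \sum_i mx_state (mx_star (mx_onb i) * a) *: mx_onb i.
Proof.
rewrite {1}[a]matrix_sum_delta pair_big /=.
rewrite (reindex (@mxtens_unindex n.+1 n.+1)) /=; last first.
  by exists (@mxtens_index _ _) => i _; rewrite (mxtens_indexK, mxtens_unindexK).
apply: eq_bigr => k _; rewrite mx_state_onb /mx_onb scalerA divfK //.
by rewrite sqrtC_eq0 pnatr_eq0.
Qed.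

Definition matrix_statedAlg : statedAlg R :=
  @StatedAlg R matrix_cstarAlg mx_state mx_state_ge0 mx_state1
    mx_state_faithful _ mx_onb mx_onb_ortho mx_onb_gen.

Let mx_coef (i : 'I_(n.+1 * n.+1)) (jk : 'I_(n.+1 * n.+1 * (n.+1 * n.+1))) :=
  [&& (mxtens_unindex i).1 == (mxtens_unindex (mxtens_unindex jk).1).1,
      (mxtens_unindex (mxtens_unindex jk).1).2
        == (mxtens_unindex (mxtens_unindex jk).2).1
    & (mxtens_unindex i).2 == (mxtens_unindex (mxtens_unindex jk).2).2].

Lemma mx_coef_sum i k :
  \sum_j (mx_coef i j)%:R * (mx_coef k j)%:R = n.+1%:R * (i == k)%:R :> C.
Proof.
have [a b] := mxtens_indexP i; have [c d] := mxtens_indexP k.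
rewrite (can_eq (@mxtens_indexK _ _)) xpair_eqE sum_tens sum_tens.
transitivity (\sum_(a' < n.+1) \sum_(x < n.+1) \sum_(y < n.+1)
    \sum_(b' < n.+1) ([&& a == a', x == y & b == b']%:R
                      * [&& c == a', x == y & d == b']%:R : C)).
  apply: eq_bigr => a' _; apply: eq_bigr => x _; rewrite sum_tens.
  apply: eq_bigr => y _; apply: eq_bigr => b' _.
  by rewrite /mx_coef !mxtens_indexK.
rewrite (bigD1 a) //= [X in _ + X]big1 ?addr0; last first.
  move=> a' ne; rewrite big1 // => x _; rewrite big1 // => y _.
  by rewrite big1 // => b' _; rewrite eq_sym (negPf ne) mul0r.
rewrite (eq_bigr (fun=> ((a == c) && (b == d))%:R)) => [|x _].
  by rewrite sumr_const card_ord mulr_natl.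
rewrite (bigD1 x) //= [X in _ + X]big1 ?addr0; last first.
  move=> y ne; rewrite big1 // => b' _.
  by rewrite [x == y]eq_sym (negPf ne) andbF mul0r.
rewrite (bigD1 b) //= [X in _ + X]big1 ?addr0; last first.
  by move=> b' ne; rewrite [b == _]eq_sym (negPf ne) !andbF mul0r.
by rewrite !eqxx mul1r [c == a]eq_sym [d == b]eq_sym.
Qed.

Lemma matrix_special :
  qmul matrix_statedAlg *m (qmul matrix_statedAlg) ^t*
    = ((n.+1%:R : R) ^+ 2)%:C%:M.
Proof.
have s0 : 0 <= sqrtC (n.+1%:R : C) by rewrite sqrtC_ge0 ler0n.
have sN0 : sqrtC (n.+1%:R : C) != 0 by rewrite sqrtC_eq0 pnatr_eq0.
have qE i jk : qmul matrix_statedAlg i jk = sqrtC n.+1%:R *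
    [&& (mxtens_unindex i).1 == (mxtens_unindex (mxtens_unindex jk).1).1,
        (mxtens_unindex (mxtens_unindex jk).1).2
          == (mxtens_unindex (mxtens_unindex jk).2).1
      & (mxtens_unindex i).2 == (mxtens_unindex (mxtens_unindex jk).2).2]%:R.
  rewrite mxE /ip [LHS]mx_state_onb /onb /= /mx_onb.
  rewrite -scalerAl -scalerAr scalerA [_ * delta_mx _ _]mul_delta_mx_cond.
  rewrite !mxE mulrC mulrA mulKf //; congr (_ * _).
  by rewrite mulrb; case: (_ == _); rewrite /= ?andbF mxE.
apply/matrixP => i k; rewrite !mxE.
under eq_bigr do rewrite [(_ ^t*) _ _]mxE [_^T _ _]mxE !qE rmorphM /=
  (geC0_conj s0) conjC_nat mulrACA -expr2 sqrtCK.
rewrite -mulr_sumr [X in _ * X](mx_coef_sum i k) rmorphXn /= rmorph_nat.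
by rewrite mulrA mulr_natr expr2.
Qed.

Lemma matrix_delta_gt0 : 0 < n.+1%:R :> R.
Proof. exact: ltr0Sn. Qed.

(* (M_(n+1), tr), with tr the normalized trace; delta = n + 1. *)
Definition matrix_qset : qset R := Qset matrix_delta_gt0 matrix_special.

End MatrixAlgebra.

(* C^(n+1) with pointwise operations; R[i]^o is R[i] as a module over itself. *)
Definition cpow (R : realType) (n : nat) := {ffun 'I_n.+1 -> R[i]^o}.

Section ClassicalSet.
Variables (R : realType) (n : nat).
Local Notation C := R[i].
Local Notation A := (cpow R n).

HB.instance Definition _ := Vector.on A.
HB.instance Definition _ := GRing.PzRing.on A.
HB.instance Definition _ :=
  GRing.PzSemiRing_isNonZero.Build A (@ffun1_nonzero _ _ (ord0 : 'I_n.+1)).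

Lemma cpow_scalerAl (z : C) (a b : A) : z *: (a * b) = (z *: a) * b.
Proof. by apply/ffunP => i; rewrite !ffunE; exact: mulrA. Qed.
HB.instance Definition _ := GRing.Lmodule_isLalgebra.Build C A cpow_scalerAl.

Lemma cpow_scalerAr (z : C) (a b : A) : z *: (a * b) = a * (z *: b).
Proof. by apply/ffunP => i; rewrite !ffunE; exact: mulrCA. Qed.
HB.instance Definition _ := GRing.Lalgebra_isAlgebra.Build C A cpow_scalerAr.
HB.instance Definition _ := Algebra_isFalgebra.Build C A.

Definition cpow_star (a : A) : A := [ffun i => (a i)^*].

Lemma cpow_star_semilinear (z : C) (a b : A) :
  cpow_star (z *: a + b) = z^* *: cpow_star a + cpow_star b.
Proof. by apply/ffunP => i; rewrite !ffunE rmorphD rmorphM. Qed.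

Lemma cpow_starM (a b : A) : cpow_star (a * b) = cpow_star b * cpow_star a.
Proof. by apply/ffunP => i; rewrite !ffunE rmorphM mulrC. Qed.

Lemma cpow_starK (a : A) : cpow_star (cpow_star a) = a.
Proof. by apply/ffunP => i; rewrite !ffunE conjCK. Qed.

Let diag (a : A) : 'M[C]_n.+1 := diag_mx (\row_i a i).

Lemma cpow_cstar_norm : exists N : A -> R, is_cstar_norm cpow_star N.
Proof.
have dD a b : diag (a + b) = diag a + diag b.
  by rewrite -raddfD /=; congr diag_mx; apply/rowP => i; rewrite !mxE ffunE.
have dZ z a : diag (z *: a) = z *: diag a.
  by rewrite -linearZ /=; congr diag_mx; apply/rowP => i; rewrite !mxE ffunE.
have dM a b : diag (a * b) = diag a *m diag b.
  rewrite mulmx_diag; congr diag_mx; apply/rowP => i; rewrite !mxE ffunE.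
  by [].
have dS a : diag (cpow_star a) = (diag a) ^t*.
  rewrite tr_diag_mx map_diag_mx; congr diag_mx.
  by apply/rowP => i; rewrite !mxE ffunE.
have d0 a : diag a = 0 -> a = 0.
  move=> /matrixP a0; apply/ffunP => i; have := a0 i i.
  by rewrite !mxE eqxx mulr1n ffunE.
exists (fun a => opn (diag a)); split.
- by split=> [a /opn_eq0/d0|a]; last exact: opn_ge0.
- by move=> a b; rewrite dD; exact: opnD.
- by move=> z a; rewrite dZ; exact: opnZ.
- by move=> a b; rewrite dM; exact: opnM.
- by move=> a; rewrite dM dS; exact: opn_cstar.
Qed.

Definition classical_cstarAlg : cstarAlg R :=
  CstarAlg cpow_star_semilinear cpow_starM cpow_starK cpow_cstar_norm.

Definition cpow_state (a : A) : C := (\sum_i a i) / n.+1%:R.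

Lemma cpow_state_linear : scalar cpow_state.
Proof.
move=> z a b; rewrite /cpow_state mulrA -mulrDl mulr_sumr -big_split /=.
by congr (_ / _); apply: eq_bigr => i _; rewrite !ffunE.
Qed.
HB.instance Definition _ :=
  GRing.isLinear.Build C A C *%R cpow_state cpow_state_linear.

Lemma cpow_stateE (a b : A) :
  cpow_state (cpow_star a * b) = (\sum_i (a i)^* * b i) / n.+1%:R.
Proof. by congr (_ / _); apply: eq_bigr => i _; rewrite !ffunE. Qed.

Lemma cpow_state_ge0 (a : A) : 0 <= cpow_state (cpow_star a * a).
Proof.
rewrite cpow_stateE divr_ge0 ?ler0n // sumr_ge0 // => i _.
by rewrite mulrC mul_conjC_ge0.
Qed.

Lemma cpow_state1 : cpow_state 1 = 1.
Proof.
rewrite /cpow_state (eq_bigr (fun=> 1)) => [|i _]; last by rewrite ffunE.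
by rewrite sumr_const card_ord divff // pnatr_eq0.
Qed.

Lemma cpow_state_faithful (a : A) : cpow_state (cpow_star a * a) = 0 -> a = 0.
Proof.
rewrite cpow_stateE => /eqP; rewrite mulf_eq0 invr_eq0 pnatr_eq0 orbF.
rewrite psumr_eq0 => [/allP a0|i _]; last by rewrite mulrC mul_conjC_ge0.
apply/ffunP => i; have := a0 i (mem_index_enum _).
by rewrite mulrC mul_conjC_eq0 ffunE => /eqP.
Qed.

Definition cpow_onb (k : 'I_n.+1) : A :=
  [ffun i => sqrtC n.+1%:R * (i == k)%:R].

Lemma cpow_state_onb (a : A) k :
  cpow_state (cpow_star (cpow_onb k) * a) = a k / sqrtC n.+1%:R.
Proof.
rewrite cpow_stateE (bigD1 k) //= [X in (_ + X) / _]big1 => [|i ne]; last first.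
  by rewrite ffunE (negPf ne) mulr0 conjC0 mul0r.
rewrite addr0 ffunE eqxx mulr1 geC0_conj ?sqrtC_ge0 ?ler0n //.
rewrite -{2}[n.+1%:R]sqrtCK expr2 invfM mulrA [sqrtC _ * _]mulrC mulfK //.
by rewrite sqrtC_eq0 pnatr_eq0.
Qed.

Lemma cpow_onb_ortho i j :
  cpow_state (cpow_star (cpow_onb i) * cpow_onb j) = (i == j)%:R.
Proof.
by rewrite cpow_state_onb ffunE mulrC mulKf ?sqrtC_eq0 ?pnatr_eq0.
Qed.

Lemma cpow_onb_gen (a : A) :
  a = \sum_i cpow_state (cpow_star (cpow_onb i) * a) *: cpow_onb i.
Proof.
apply/ffunP => i; rewrite sum_ffunE (bigD1 i) //= [X in _ + X]big1; last first.
  move=> k ne; rewrite !ffunE eq_sym (negPf ne) mulr0; exact: mulr0.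
rewrite addr0 cpow_state_onb !ffunE eqxx mulr1.
by rewrite [_ *: _]divfK // sqrtC_eq0 pnatr_eq0.
Qed.

Definition classical_statedAlg : statedAlg R :=
  @StatedAlg R classical_cstarAlg cpow_state cpow_state_ge0 cpow_state1
    cpow_state_faithful _ cpow_onb cpow_onb_ortho cpow_onb_gen.

Let cpow_coef (i : 'I_n.+1) (jk : 'I_(n.+1 * n.+1)) :=
  (i == (mxtens_unindex jk).1) && (i == (mxtens_unindex jk).2).

Lemma cpow_coef_sum i k :
  \sum_j (cpow_coef i j)%:R * (cpow_coef k j)%:R = (i == k)%:R :> C.
Proof.
rewrite sum_tens (bigD1 i) //= [X in _ + X]big1 ?addr0; last first.
  move=> a ne; rewrite big1 // => b _.
  by rewrite /cpow_coef !mxtens_indexK /= eq_sym (negPf ne) mul0r.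
rewrite (bigD1 i) //= [X in _ + X]big1 ?addr0; last first.
  move=> b ne.
  by rewrite /cpow_coef !mxtens_indexK /= [i == b]eq_sym (negPf ne) andbF mul0r.
by rewrite /cpow_coef !mxtens_indexK /= !eqxx mul1r andbb eq_sym.
Qed.

Lemma classical_special :
  qmul classical_statedAlg *m (qmul classical_statedAlg) ^t*
    = (Num.sqrt (n.+1%:R : R) ^+ 2)%:C%:M.
Proof.
have s0 : 0 <= sqrtC (n.+1%:R : C) by rewrite sqrtC_ge0 ler0n.
have sN0 : sqrtC (n.+1%:R : C) != 0 by rewrite sqrtC_eq0 pnatr_eq0.
have qE (i : 'I_n.+1) (jk : 'I_(n.+1 * n.+1)) :
    qmul classical_statedAlg i jk = sqrtC n.+1%:R *
      ((i == (mxtens_unindex jk).1) && (i == (mxtens_unindex jk).2))%:R.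
  rewrite mxE /ip [LHS]cpow_state_onb /onb /= !ffunE.
  have E (s x y : C) : s != 0 -> s * x * (s * y) / s = s * (x * y).
    by move=> ?; rewrite mulrCA mulrAC divff // mul1r mulrA.
  by rewrite -mulnb natrM; exact: E.
apply/matrixP => i k; rewrite !mxE.
under eq_bigr do rewrite [(_ ^t*) _ _]mxE [_^T _ _]mxE !qE rmorphM /=
  (geC0_conj s0) conjC_nat mulrACA -expr2 sqrtCK.
rewrite -mulr_sumr [X in _ * X](cpow_coef_sum i k) sqr_sqrtr ?ler0n //.
by rewrite rmorph_nat mulr_natr.
Qed.

Lemma classical_delta_gt0 : 0 < Num.sqrt (n.+1%:R : R).
Proof. by rewrite sqrtr_gt0 ltr0Sn. Qed.

(* The classical set with n + 1 points; delta^2 = n + 1. *)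
Definition classical_qset : qset R :=
  Qset classical_delta_gt0 classical_special.

End ClassicalSet.

(** * Classical graphs *)

Section ClassicalGraph.
Variables (R : realType) (X : qset R).

Definition qiso_to_classical (T : 'M[R[i]]_(qdim X)) : Prop :=
  exists (n : nat) (T' : 'M[R[i]]_(qdim (classical_qset R n))),
    quantum_graph T' /\ quantum_isomorphic T T'.

End ClassicalGraph.

(** * The operator G_4 on l^2(M_3) *)

Section G4.
Variable R : realType.
Local Notation C := R[i].

Definition G4_unit (i j : 'I_3) : 'M[C]_3 :=
  if i == j then (3 / 2) *: \sum_(k | k != i) delta_mx k k
  else (3 / 2) *: delta_mx j i.

Definition G4_map (a : 'M[C]_3) : 'M[C]_3 := \sum_i \sum_j a i j *: G4_unit i j.

Lemma G4_map_linear : linear G4_map.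
Proof.
move=> z a b; rewrite /G4_map scaler_sumr -big_split; apply: eq_bigr => i _.
rewrite scaler_sumr -big_split; apply: eq_bigr => j _.
by rewrite !mxE scalerDl scalerA.
Qed.
HB.instance Definition _ := GRing.isLinear.Build C _ _ _ G4_map G4_map_linear.

Lemma G4_map_delta i j : G4_map (delta_mx i j) = G4_unit i j.
Proof.
rewrite /G4_map (bigD1 i) //= [X in _ + X]big1 ?addr0; last first.
  move=> k ne; rewrite big1 // => l _.
  by rewrite !mxE (negPf ne) scale0r.
rewrite (bigD1 j) //= [X in _ + X]big1 ?addr0; last first.
  by move=> l ne; rewrite !mxE (negPf ne) andbF scale0r.
by rewrite !mxE !eqxx scale1r.
Qed.

Definition G4 : 'M[C]_(qdim (matrix_qset R 2)) :=
  @opmx R (matrix_qset R 2) G4_map.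

End G4.

(* Main.v *)
Require Import Defs.
From mathcomp Require Import all_boot all_order all_algebra all_field.
From mathcomp Require Import all_real_closed reals ring zify.

(* With E = iota iota^* and T = G_4 or G_6, one has T^2 + a T = q + c E, where
   (a, q, c) = (0, 9/4, 27/4) for G_4 and (2, 5/4, 135/4) for G_6.  Since
   L(T) = k - T for a k-regular graph, this relation confines ker L(T) to the
   line spanned by iota.  A quantum isomorphism P intertwines T with T' and E
   with E', and M (x) 1 kills P only if M = 0, so T' satisfies the same
   relation.  Over a classical set T' is a 0/1 matrix and E' is constant, so the
   diagonal and off-diagonal entries of T'^2 + a T' would be integers differing
   by q, which is not an integer. *)

Set Implicit Arguments.
Unset Strict Implicit.
Unset Printing Implicit Defensive.

Import Order.TTheory GRing.Theory Num.Theory.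
Local Open Scope complex_scope.
Local Open Scope sesquilinear_scope.
Local Open Scope ring_scope.

(** * Entrywise calculus for the coherence isomorphisms *)

Section Coherence.
Variable C : comNzRingType.

(** The two equality proofs are independent, so this cancels any unitor or associator against its
    inverse. *)
Lemma castmx1K m m' (e : m = m') (e' : m' = m) :
  castmx (e, erefl m) 1%:M *m castmx (e', erefl m') 1%:M = 1%:M :> 'M[C]_m'.
Proof. by case: m' / e e' => e'; rewrite !castmx_id mulmx1. Qed.

Lemma mul_castmx1 m m' p (e : m = m') (M : 'M[C]_(p, m')) :
  M *m castmx (e, erefl m) 1%:M = castmx (erefl p, esym e) M.
Proof. by case: m' / e M => M; rewrite !castmx_id mulmx1. Qed.

(** A coherence isomorphism is a cast identity matrix: multiplying by it only rebrackets the index,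
    whose numerical value is unchanged. *)
Lemma lunit_mulE a p (M : 'M[C]_(1 * a, p)) i j :
  (lunit a *m M) i j = M (mxtens_index (0, i)) j.
Proof. by rewrite castmx1_mul castmxE; congr (M _ _); exact: val_inj. Qed.

Lemma mul_runitVE a p (M : 'M[C]_(p, a * 1)) i j :
  (M *m runitV a) i j = M i (mxtens_index (j, 0)).
Proof.
rewrite mul_castmx1 castmxE; congr (M _ _); apply: val_inj => //.
by rewrite /= muln1 addn0.
Qed.

Lemma assocV_mulE a b d p (M : 'M[C]_(a * (b * d), p)) i j l c :
  (assocV a b d *m M) (mxtens_index (mxtens_index (i, j), l)) c
    = M (mxtens_index (i, mxtens_index (j, l))) c.
Proof.
rewrite castmx1_mul castmxE; congr (M _ _); apply: val_inj => //.
by rewrite /= mulnDl mulnA addnA.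
Qed.

Lemma mul_assocVE a b d p (M : 'M[C]_(p, a * b * d)) i j l r :
  (M *m assocV a b d) r (mxtens_index (i, mxtens_index (j, l)))
    = M r (mxtens_index (mxtens_index (i, j), l)).
Proof.
rewrite mul_castmx1 castmxE; congr (M _ _); apply: val_inj => //.
by rewrite /= mulnDl mulnA addnA.
Qed.

Lemma assocV_nat a b d a' b' d' (A : 'M[C]_(a, a')) (B : 'M[C]_(b, b'))
    (D : 'M[C]_(d, d')) :
  (A *t B *t D) *m assocV a' b' d' = assocV a b d *m (A *t (B *t D)).
Proof.
apply/matrixP => r c.
have [ij l] := mxtens_indexP r; have [i j] := mxtens_indexP ij.
have [i' jl'] := mxtens_indexP c; have [j' l'] := mxtens_indexP jl'.
by rewrite mul_assocVE assocV_mulE !tensmxE mulrA.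
Qed.

(** This is where [H] being nonzero enters: one diagonal entry of its identity is needed to read off
    the entries of [A]. *)
Lemma tensmx1_eq0 a b d (A : 'M[C]_(a, b)) :
  (0 < d)%N -> A *t (1%:M : 'M[C]_d) = 0 -> A = 0.
Proof.
move=> d0 /matrixP A0; apply/matrixP => i j.
have := A0 (mxtens_index (i, Ordinal d0)) (mxtens_index (j, Ordinal d0)).
by rewrite tensmxE !mxE eqxx mulr1.
Qed.

End Coherence.

Lemma trmxCE (R : realType) m n (M : 'M[R[i]]_(m, n)) i j :
  (M ^t*) i j = (M j i)^*.
Proof. by rewrite !mxE. Qed.

(** * Evaluation, coevaluation and the counit law in coordinates *)

Section StatedAlg.
Variables (R : realType) (X : statedAlg R).
Local Notation C := R[i].
Local Notation n := (qdim X).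

Lemma star0 : star (0 : X) = 0.
Proof.
have := star_semilinear (1 : C) (0 : X) 0.
rewrite scaler0 addr0 conjC1 scale1r => /eqP.
by rewrite -subr_eq0 opprD addrA subrr sub0r oppr_eq0 => /eqP.
Qed.

Lemma starZ (z : C) (a : X) : star (z *: a) = z^* *: star a.
Proof. by have := star_semilinear z a 0; rewrite !addr0 star0 addr0. Qed.

Lemma starD (a b : X) : star (a + b) = star a + star b.
Proof. by have := star_semilinear 1 a b; rewrite conjC1 !scale1r. Qed.

Lemma star1 : star (1 : X) = 1.
Proof. by rewrite -[LHS]mulr1 -[X in _ * X]starK -starM mulr1 starK. Qed.

Lemma qmulE i j k :
  qmul X i (mxtens_index (j, k)) = ip (onb i) (onb j * onb k : X).
Proof. by rewrite mxE mxtens_indexK. Qed.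

Lemma sum_qunit : \sum_k qunit X k 0 *: onb k = 1 :> X.
Proof. by rewrite [RHS]onb_gen; apply: eq_bigr => k _; rewrite mxE. Qed.

Lemma qevE i j : qev X 0 (mxtens_index (i, j)) = psi X (onb i * onb j).
Proof.
rewrite mxE; under eq_bigr do rewrite qmulE trmxCE.
rewrite -[in RHS](mul1r (onb i * onb j)) -star1 -sum_qunit.
rewrite (big_morph _ starD star0) mulr_suml linear_sum; apply: eq_bigr => k _.
by rewrite starZ -scalerAl linearZ.
Qed.

Lemma qcoevE i j :
  qcoev X (mxtens_index (i, j)) 0 = (psi X (onb i * onb j))^*.
Proof.
have -> : qcoev X = (qev X) ^t*.
  by rewrite /qev /qcoev trmx_mul map_mxM trmxCK.
by rewrite trmxCE qevE.
Qed.

(** Adjoint of the unit law: the entries are the conjugates of [ip (onb j) (1 * onb i)]. *)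
Lemma counit_l :
  lunit n *m ((qunit X) ^t* *t 1%:M) *m (qmul X) ^t* = 1%:M :> 'M[C]_n.
Proof.
apply/matrixP => i j; rewrite -mulmxA lunit_mulE mxE sum_tens.
transitivity ((ip (onb j) (onb i : X))^*); last first.
  by rewrite /ip onb_ortho conjC_nat mxE eq_sym.
rewrite -[onb i in RHS]mul1r -sum_qunit mulr_suml linear_sum rmorph_sum.
apply: eq_bigr => k _; rewrite (bigD1 i) //= [X in _ + X]big1 ?addr0; last first.
  by move=> l ne; rewrite tensmxE !mxE eq_sym (negPf ne) mulr0 mul0r.
rewrite tensmxE -[in RHS]scalerAl linearZ rmorphM /=.
by rewrite [1%:M _ _]mxE eqxx mulr1 !trmxCE qmulE.
Qed.

(* [psi] is faithful, so [coev] is nondegenerate. *)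
Lemma coev_inj (M : 'M[C]_n) : (1%:M *t M) *m qcoev X = 0 -> M = 0.
Proof.
move=> /matrixP M0; apply/matrixP => z y; rewrite [RHS]mxE.
(* Row [z] of [M] as an algebra element, conjugated to match [qcoev]. The hypothesis gives
   [psi (onb x * v) = 0] for every [x], hence [psi (star v * v) = 0]. *)
pose v : X := \sum_y (M z y)^* *: onb y.
have v0 x : psi X (onb x * v) = 0.
  apply: (can_inj conjCK); rewrite conjC0.
  have := M0 (mxtens_index (x, z)) 0; rewrite [RHS]mxE => <-.
  rewrite mxE sum_tens (bigD1 x) //= [X in _ + X]big1 ?addr0; last first.
    move=> x' ne; rewrite big1 // => w _.
    by rewrite tensmxE !mxE eq_sym (negPf ne) !mul0r.
  rewrite mulr_sumr linear_sum rmorph_sum; apply: eq_bigr => w _.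
  by rewrite tensmxE mxE eqxx mul1r qcoevE -scalerAr linearZ /= rmorphM /= conjCK.
have vv : psi X (star v * v) = 0.
  rewrite {1}[star v]onb_gen mulr_suml linear_sum big1 // => x _.
  by rewrite -scalerAl linearZ /= v0 mulr0.
have := congr1 (fun w => (ip (onb y) w)^*) (psi_faithful vv).
rewrite linear0 conjC0 => <-.
rewrite linear_sum (bigD1 y) //= [X in _ + X]big1 ?addr0; last first.
  by move=> w ne; rewrite linearZ /= /ip onb_ortho eq_sym (negPf ne) mulr0.
by rewrite linearZ /= /ip onb_ortho eqxx mulr1 conjCK.
Qed.

End StatedAlg.

(** * Transfer of operator relations along a quantum isomorphism *)

Section QuantumIsomorphism.
Variables (R : realType) (X X' : qset R) (d : nat).
Local Notation C := R[i].
Local Notation n := (qdim X).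
Local Notation n' := (qdim X').
Variable P : 'M[C]_(n' * d, d * n).

(** The last condition of [is_qiso] on its own. It is stable under products and linear combinations,
    so polynomial expressions in intertwined operators are intertwined. *)
Definition intertwines (T : 'M[C]_n) (T' : 'M[C]_n') : Prop :=
  P *m (1%:M *t T) = (T' *t 1%:M) *m P.

Lemma intertwinesM S S' T T' :
  intertwines S S' -> intertwines T T' -> intertwines (S *m T) (S' *m T').
Proof.
rewrite /intertwines => PS PT.
rewrite -[1%:M in LHS]mulmx1 -[1%:M in RHS]mulmx1 -!tensmx_mul.
by rewrite mulmxA PS -mulmxA PT mulmxA.
Qed.

Lemma intertwinesD S S' T T' :
  intertwines S S' -> intertwines T T' -> intertwines (S + T) (S' + T').
Proof.
rewrite /intertwines => PS PT.
have -> : 1%:M *t (S + T) = 1%:M *t S + (1%:M : 'M[C]_d) *t T.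
  by apply/matrixP => i j; rewrite !mxE mulrDr.
have -> : (S' + T') *t 1%:M = S' *t 1%:M + T' *t (1%:M : 'M[C]_d).
  by apply/matrixP => i j; rewrite !mxE mulrDl.
by rewrite mulmxDr mulmxDl PS PT.
Qed.

Lemma intertwinesZ (z : C) T T' :
  intertwines T T' -> intertwines (z *: T) (z *: T').
Proof.
rewrite /intertwines => PT.
have -> : 1%:M *t (z *: T) = z *: ((1%:M : 'M[C]_d) *t T).
  by apply/matrixP => i j; rewrite !mxE mulrCA.
have -> : (z *: T') *t 1%:M = z *: (T' *t (1%:M : 'M[C]_d)).
  by apply/matrixP => i j; rewrite !mxE mulrA.
by rewrite -scalemxAr -scalemxAl PT.
Qed.

Lemma intertwines1 : intertwines 1%:M 1%:M.
Proof.
rewrite /intertwines.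
have tens1 a b : 1%:M *t 1%:M = 1%:M :> 'M[C]_(a * b).
  apply/matrixP => i j; have [i1 i2] := mxtens_indexP i.
  have [j1 j2] := mxtens_indexP j; rewrite tensmxE !mxE -natrM mulnb.
  by rewrite (can_eq (@mxtens_indexK _ _)).
by rewrite !tens1 mulmx1 mul1mx.
Qed.

Variables (T : 'M[C]_n) (T' : 'M[C]_n').
Hypotheses (d0 : (0 < d)%N) (PT : is_qiso T T' P).

Lemma qiso_unit :
  P *m (1%:M *t qunit X) = (qunit X' *t 1%:M) *m lunitV d *m runit d.
Proof.
by case: PT => -[_ _ _ _ <-] _; rewrite -!mulmxA castmx1K !mulmx1.
Qed.

(** The unit condition moves [P] past [iota], the counit condition past its adjoint, and the unitors
    in between cancel. *)
Lemma qiso_rank1 : intertwines (qunit X *m (qunit X) ^t*)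
                               (qunit X' *m (qunit X') ^t*).
Proof.
case: PT => -[_ counitP _ _ _] _; rewrite /intertwines.
rewrite -[1%:M in LHS]mulmx1 -[1%:M in RHS]mulmx1 -!tensmx_mul.
rewrite mulmxA qiso_unit -!mulmxA -counitP.
by congr (_ *m _); rewrite !mulmxA castmx1K mul1mx.
Qed.

(* [(m'^* (x) 1) P (1 (x) iota)] equals both [coev' (x) 1] and
   [(1 (x) P) (P (x) 1) (1 (x) coev)]; so [M (x) 1] killing [P] kills [coev']. *)
Lemma qiso_inj (M : 'M[C]_n') : (M *t 1%:M) *m P = 0 -> M = 0.
Proof.
case: PT => -[comulP _ _ _ _] _ MP; apply: coev_inj; apply: (tensmx1_eq0 d0).
(* By naturality of the associator, [M] on the second leg meets [P] directly. *)
have kill p (Q : 'M[C]_(n' * (d * n), p)) :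
    (1%:M *t M *t 1%:M) *m (assocV n' n' d *m ((1%:M *t P) *m Q)) = 0.
  rewrite !mulmxA assocV_nat -(mulmxA (assocV _ _ _)) tensmx_mul MP.
  by rewrite tensmx0 mulmx0 mul0mx.
(* The trailing unitors are those produced by [qiso_unit]; they are invertible, so they may be
   appended here. *)
suff: (1%:M *t M *m qcoev X') *t (1%:M : 'M[C]_d) *m (lunitV d *m runit d) = 0.
  move/(congr1 (mulmx^~ (runitV d *m lunit d))).
  rewrite mul0mx !mulmxA -!(mulmxA _ (runit d)) castmx1K mulmx1.
  by rewrite -!mulmxA castmx1K mulmx1.
have -> : (1%:M *t M *m qcoev X') *t (1%:M : 'M[C]_d)
    = (1%:M *t M *t 1%:M) *m (((qmul X') ^t* *t 1%:M) *m (qunit X' *t 1%:M)).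
  by rewrite !tensmx_mul !mul1mx.
rewrite -mulmxA -[X in _ *m X]mulmxA [X in _ *m (_ *m X)]mulmxA -qiso_unit.
by rewrite [X in _ *m X]mulmxA comulP -!mulmxA kill.
Qed.

End QuantumIsomorphism.

(** * Graphs over classical sets and the integrality obstruction *)

Section ClassicalSet.
Variables (R : realType) (n : nat).
Local Notation C := R[i].
Local Notation X := (classical_qset R n).

Lemma sqrtC_natr_neq0 : sqrtC (n.+1%:R : C) != 0.
Proof. by rewrite sqrtC_eq0 pnatr_eq0. Qed.

Lemma conj_sqrtC_natr : (sqrtC (n.+1%:R : C))^* = sqrtC n.+1%:R.
Proof. by rewrite geC0_conj // sqrtC_ge0 ler0n. Qed.

Lemma classical_qmulE (i j k : 'I_n.+1) :
  qmul X i (mxtens_index (j, k)) = sqrtC n.+1%:R * ((i == j) && (i == k))%:R.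
Proof.
rewrite qmulE /ip [LHS]cpow_state_onb /onb /= !ffunE.
have scal (s x y : C) : s != 0 -> s * x * (s * y) / s = s * (x * y).
  by move=> s0; rewrite mulrCA mulrAC divff // mul1r mulrA.
by rewrite -mulnb natrM; exact/scal/sqrtC_natr_neq0.
Qed.

Lemma classical_qunitE (i : 'I_n.+1) : qunit X i 0 = (sqrtC n.+1%:R)^-1.
Proof. by rewrite mxE /ip [LHS]cpow_state_onb ffunE mul1r. Qed.

Lemma classical_rank1E (i j : 'I_n.+1) :
  (qunit X *m (qunit X) ^t*) i j = n.+1%:R^-1.
Proof.
rewrite mxE big_ord1 classical_qunitE trmxCE classical_qunitE fmorphV /=.
by rewrite conj_sqrtC_natr -invfM -expr2 sqrtCK.
Qed.

(** [qmul] is supported on equal indices, with weight the square root of [n + 1]: one term of each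
    sum survives, and the two weights cancel the square of [delta]. *)
Lemma classical_schurE (S T : 'M[C]_(qdim X)) (i j : 'I_n.+1) :
  schur S T i j = S i j * T i j.
Proof.
rewrite /schur mxE /delta /= sqr_sqrtr ?ler0n // rmorph_nat.
rewrite mxE sum_tens (bigD1 j) //= [X in _ + X]big1 ?addr0; last first.
  move=> k ne; rewrite big1 // => l _; rewrite trmxCE.
  by rewrite classical_qmulE eq_sym (negPf ne) mulr0 conjC0 mulr0.
rewrite (bigD1 j) //= [X in _ + X]big1 ?addr0; last first.
  move=> k ne; rewrite trmxCE.
  by rewrite classical_qmulE [j == k]eq_sym (negPf ne) andbF mulr0 conjC0 mulr0.
rewrite trmxCE classical_qmulE !eqxx mulr1.
rewrite conj_sqrtC_natr.
rewrite mxE sum_tens (bigD1 i) //= [X in _ + X]big1 ?addr0; last first.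
  move=> k ne; rewrite big1 // => l _.
  by rewrite classical_qmulE eq_sym (negPf ne) mulr0 mul0r.
rewrite (bigD1 i) //= [X in _ + X]big1 ?addr0; last first.
  move=> k ne.
  by rewrite classical_qmulE [i == k]eq_sym (negPf ne) andbF mulr0 mul0r.
rewrite classical_qmulE !eqxx mulr1 tensmxE mulrAC -expr2 sqrtCK.
by rewrite mulKf // pnatr_eq0.
Qed.

(** By [classical_schurE] every entry is an idempotent of a field. *)
Lemma classical_graph_int (T : 'M[C]_(qdim X)) : quantum_graph T ->
  exists B : 'M[int]_n.+1,
    (forall i j, B i j = 0 \/ B i j = 1) /\ T = map_mx intr B.
Proof.
move=> gT; exists (\matrix_(i, j) (T i j == 1)%:Z); split.
  by move=> i j; rewrite mxE; case: (_ == _); [right | left].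
apply/matrixP => i j; rewrite !mxE.
have /eqP := congr1 (fun M : 'M[C]_n.+1 => M i j) gT.
rewrite classical_schurE -subr_eq0 -{3}[T i j]mulr1 -mulrBr mulf_eq0 subr_eq0.
by case/orP => /eqP ->; rewrite ?eqxx // eq_sym oner_eq0.
Qed.

End ClassicalSet.

(* The last two hypotheses exclude the one-point set, which has no off-diagonal
   entry. *)
Lemma not_qiso_to_classical (R : realType) (X : qset R) (T : 'M[R[i]]_(qdim X))
    (a : int) (q c : R[i]) :
    T *m T + a%:~R *: T = q%:M + c *: (qunit X *m (qunit X) ^t*) ->
    (forall z : int, q <> z%:~R) -> q + c <> 0 -> q + c <> 1 + a%:~R ->
  ~ qiso_to_classical T.
Proof.
move=> ET qZ qc0 qc1 [n [T' [/classical_graph_int[B [B01 ->]] [d [P [d0 PT]]]]]].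
set Y := classical_qset R n in P PT.
set T1 : 'M_(qdim Y) := map_mx intr B in PT.
have T1E : T1 *m T1 + a%:~R *: T1 = q%:M + c *: (qunit Y *m (qunit Y) ^t*).
  apply/eqP; rewrite -subr_eq0; apply/eqP; apply: (qiso_inj d0 PT).
  have PI : intertwines P T T1 by case: PT.
  (* The defect of the relation for [T1] is intertwined with that for [T], which vanishes by [ET];
     so it kills [P]. *)
  have := intertwinesD (intertwinesD (intertwinesM PI PI) (intertwinesZ a%:~R PI))
    (intertwinesZ (-1) (intertwinesD (intertwinesZ q (intertwines1 P))
       (intertwinesZ c (qiso_rank1 PT)))).
  rewrite /intertwines !scaleN1r !scalemx1 ET subrr tensmx0 mulmx0.
  by move<-.
have entry (i j : 'I_n.+1) :
    ((B *m B) i j + a * B i j)%:~R = q *+ (i == j) + c / n.+1%:R.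
  have := congr1 (fun M : 'M[R[i]]_n.+1 => M i j) T1E.
  rewrite -map_mxM ![fun_of_matrix (_ + _) _ _]mxE.
  rewrite ![fun_of_matrix (_ *: _) _ _]mxE classical_rank1E.
  rewrite ![fun_of_matrix (map_mx _ _) _ _]mxE [fun_of_matrix _%:M _ _]mxE.
  by move=> <-; rewrite rmorphD rmorphM.
move: {T' Y P T1 PT T1E d d0} B B01 entry; case: n => [|n] B B01 entry.
  (* The only entry [b] is 0 or 1, so [q + c = b * b + a * b] is 0 or [1 + a]. *)
  have := entry ord0 ord0; rewrite eqxx divr1 mxE big_ord1.
  case: (B01 ord0 ord0) => ->; first by rewrite !mulr0 => /esym.
  by rewrite !mulr1 rmorphD => /esym.
have := entry ord0 ord_max; rewrite mulr0n add0r => E.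
have := entry ord0 ord0; rewrite eqxx -E => /eqP.
by rewrite -subr_eq -rmorphB => /eqP/esym/qZ.
Qed.

(** * Laplacians, connectedness and complements of regular graphs *)

Section RegularGraph.
Variables (R : realType) (X : qset R).
Local Notation C := R[i].
Local Notation n := (qdim X).
Local Notation iota := (qunit X).
Implicit Types T : 'M[C]_n.

Lemma qunit_normed : iota ^t* *m iota = 1%:M.
Proof.
apply/matrixP => i j; rewrite !ord1 mxE [RHS]mxE eqxx -(psi1 X).
rewrite -[in RHS](mulr1 (1 : X)) -[X in X * 1]star1 -sum_qunit.
rewrite (big_morph _ (@starD _ _) (star0 X)) mulr_suml linear_sum.
apply: eq_bigr => k _; rewrite starZ -scalerAl linearZ trmxCE /=.
by congr (_ * _); rewrite mxE sum_qunit.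
Qed.

(** The degree term involves [T] only through [iota ^t* *m T], so regularity reduces it to [k] times
    the counit law. *)
Lemma laplacian_regular T k :
  iota ^t* *m T = k *: iota ^t* -> laplacian T = k%:M - T.
Proof.
move=> iT; rewrite /laplacian -[_ *m (T *t _)]mulmxA tensmx_mul iT mulmx1.
have -> : (k *: iota ^t*) *t 1%:M = k *: (iota ^t* *t (1%:M : 'M[C]_n)).
  by apply/matrixP => i j; rewrite !mxE mulrA.
by rewrite -scalemxAr -scalemxAl counit_l scalemx1.
Qed.

(* On [ker (k - T)] the quadratic relation reads
   [(k^2 + a k - q) v = c iota iota^* v]. *)
Lemma connected_quadratic T (k a q c : C) :
    T *m iota = k *: iota -> iota ^t* *m T = k *: iota ^t* ->
    T *m T + a *: T = q%:M + c *: (iota *m iota ^t*) ->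
    k ^+ 2 + a * k - q != 0 ->
  connected_graph T.
Proof.
move=> Ti iT ET kq; rewrite /connected_graph (laplacian_regular iT).
set L := _ - T; apply/eqP; rewrite eqn_leq; apply/andP; split; last first.
  (* Rank at least one: otherwise [L] would be invertible, yet it kills the unit vector [iota]. *)
  rewrite mxrank_coker subn_gt0 ltn_neqAle rank_leq_row andbT.
  apply/negP => /eqP Lfull.
  have Lu : L \in unitmx by rewrite -row_free_unit /row_free Lfull.
  have : L *m iota = 0 by rewrite mulmxBl mul_scalar_mx Ti subrr.
  move/(congr1 (mulmx (invmx L))); rewrite mulKmx // mulmx0 => i0.
  have := qunit_normed; rewrite i0 mulmx0 => /matrixP/(_ 0 0)/eqP.
  by rewrite !mxE eq_sym oner_eq0.
(* Rank at most one: [V] factors through the single column [iota]. *)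
move: (cokermx L) (mulmx_coker L) => V LV.
have TV : T *m V = k *: V.
  by move: LV; rewrite mulmxBl mul_scalar_mx => /eqP; rewrite subr_eq0 => /eqP.
have VE : (k ^+ 2 + a * k - q) *: V = c *: (iota *m (iota ^t* *m V)).
  have := congr1 (mulmx^~ V) ET.
  rewrite /= !mulmxDl -mulmxA -!scalemxAl TV -scalemxAr TV !scalerA.
  rewrite mul_scalar_mx -mulmxA => E.
  by rewrite expr2 scalerBl scalerDl E addrAC subrr add0r.
have -> : V = iota *m ((k ^+ 2 + a * k - q)^-1 *: (c *: (iota ^t* *m V))).
  by rewrite -!scalemxAr -VE scalerA mulVf // scale1r.
by apply: leq_trans (mxrankM_maxl _ _) _; exact: rank_leq_col.
Qed.

Local Notation delta2 := ((delta X ^+ 2)%:C).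

Lemma graph_compl_qunit T k :
  T *m iota = k *: iota -> graph_compl T *m iota = (delta2 - 1 - k) *: iota.
Proof.
move=> Ti; rewrite /graph_compl /Jop !mulmxBl -scalemxAl -mulmxA qunit_normed.
by rewrite mulmx1 mul1mx Ti !scalerBl scale1r.
Qed.

Lemma qunit_graph_compl T k : iota ^t* *m T = k *: iota ^t* ->
  iota ^t* *m graph_compl T = (delta2 - 1 - k) *: iota ^t*.
Proof.
move=> iT; rewrite /graph_compl /Jop !mulmxBr -scalemxAr mulmxA qunit_normed.
by rewrite mulmx1 mul1mx iT !scalerBl scale1r.
Qed.

(* [Tc^2 + 2 Tc = (J - 1 - T) (J + 1 - T)], where [J T = T J = k J]. *)
Lemma graph_compl_quadratic T (k q c : C) :
    T *m iota = k *: iota -> iota ^t* *m T = k *: iota ^t* ->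
    T *m T = q%:M + c *: (iota *m iota ^t*) ->
  graph_compl T *m graph_compl T + 2%:~R *: graph_compl T
    = (q - 1)%:M
      + (delta2 ^+ 2 - 2 * k * delta2 + c) *: (iota *m iota ^t*).
Proof.
move=> Ti iT; set E := iota *m iota ^t* => TT.
have ET : E *m T = k *: E by rewrite -mulmxA iT -scalemxAr.
have TE : T *m E = k *: E by rewrite mulmxA Ti -scalemxAl.
have EE : E *m E = E.
  by rewrite mulmxA -[_ *m _ *m iota]mulmxA qunit_normed mulmx1.
rewrite /graph_compl /Jop -/E; move: (delta2) => D.
rewrite !mulmxBl !mulmxBr -!scalemxAl -!scalemxAr EE ET TE TT !mul1mx !mulmx1.
(* No operator product is left, so the identity is linear in [1], [T] and [E] and can be checked
   entrywise. *)
move: E {ET TE EE TT} => E.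
apply/matrixP => i j; rewrite !mxE; move: (T i j) (E i j) => t e.
by case: (i == j); rewrite ?mulr1n ?mulr0n; ring.
Qed.

(** The identity wires force all indices except those of the two legs of [T]. *)
Lemma opstarE T a b : opstar T a b =
  \sum_p \sum_d qev X 0 (mxtens_index (b, p)) * (T d p)^*
                * qcoev X (mxtens_index (d, a)) 0.
Proof.
rewrite /opstar mul_runitVE -!mulmxA lunit_mulE tensmx_mul mulmx1.
rewrite mxE sum_tens sum_tens (bigD1 b) //= [X in _ + X]big1 ?addr0; last first.
  move=> p ne; rewrite big1 // => p' _; rewrite big1 // => p'' _.
  rewrite assocV_mulE [X in _ * X]tensmxE [X in _ * (X * _)]mxE (negPf ne).
  by rewrite mul0r mulr0.
apply: eq_bigr => p _; rewrite (bigD1 a) //= [X in _ + X]big1 ?addr0; last first.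
  move=> p' ne; rewrite tensmxE [X in _ * X * _]mxE eq_sym (negPf ne).
  by rewrite mulr0 mul0r.
rewrite assocV_mulE !tensmxE.
rewrite [X in _ * X * _]mxE [X in _ * (X * _)]mxE !eqxx mulr1 mul1r.
rewrite [X in _ * X]mxE sum_tens mulr_sumr; apply: eq_bigr => d _.
rewrite (bigD1 a) //= [X in _ + X]big1 ?addr0; last first.
  by move=> l ne; rewrite tensmxE [1%:M _ _]mxE eq_sym (negPf ne) mulr0 mul0r.
by rewrite tensmxE [1%:M _ _]mxE eqxx mulr1 trmxCE mulrA.
Qed.

End RegularGraph.

(** * Graph operations over the matrix algebra, in matrix-unit indices *)

Section MatrixAlgebra.
Variables (R : realType) (n : nat).
Local Notation C := R[i].
Local Notation X := (matrix_qset R n).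
Implicit Types (i j k a b : 'I_n.+1).

(** The basis consists of matrix units with a common scalar factor, which cancels. *)
Lemma matrix_opmxE (f : {linear 'M[C]_n.+1 -> 'M[C]_n.+1}) a1 a2 b1 b2 :
  @opmx R X f (mxtens_index (a1, a2)) (mxtens_index (b1, b2))
    = f (delta_mx b1 b2) a1 a2.
Proof.
rewrite mxE /ip [LHS]mx_state_onb mxtens_indexK /onb /= /mx_onb mxtens_indexK.
by rewrite linearZ mxE mulrC mulKf // sqrtC_natr_neq0.
Qed.

Lemma matrix_qmulE i1 i2 j1 j2 k1 k2 :
  qmul X (mxtens_index (i1, i2))
    (mxtens_index (mxtens_index (j1, j2), mxtens_index (k1, k2)))
  = sqrtC n.+1%:R * [&& i1 == j1, j2 == k1 & i2 == k2]%:R.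
Proof.
rewrite qmulE /ip [LHS]mx_state_onb mxtens_indexK /onb /= /mx_onb !mxtens_indexK /=.
rewrite -scalerAl -scalerAr scalerA [_ * delta_mx _ _]mul_delta_mx_cond.
rewrite !mxE mulrC mulrA mulKf ?sqrtC_natr_neq0 //; congr (_ * _).
by rewrite mulrb; case: (j2 == k1); rewrite /= ?andbF mxE.
Qed.

Lemma matrix_qunitE i1 i2 :
  qunit X (mxtens_index (i1, i2)) 0 = (i1 == i2)%:R / sqrtC n.+1%:R.
Proof. by rewrite mxE /ip [LHS]mx_state_onb mxtens_indexK mxE. Qed.

Lemma matrix_rank1E a1 a2 b1 b2 :
  (qunit X *m (qunit X) ^t*) (mxtens_index (a1, a2)) (mxtens_index (b1, b2))
    = ((a1 == a2) && (b1 == b2))%:R / n.+1%:R.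
Proof.
rewrite mxE big_ord1 matrix_qunitE trmxCE matrix_qunitE fmorph_div /=.
rewrite conj_sqrtC_natr conjC_nat mulrACA -natrM mulnb.
by rewrite -invfM -expr2 sqrtCK.
Qed.

Lemma matrix_qevE i1 i2 j1 j2 :
  qev X 0 (mxtens_index (mxtens_index (i1, i2), mxtens_index (j1, j2)))
    = ((i1 == j2) && (i2 == j1))%:R.
Proof.
rewrite qevE -[onb _]starK.
have -> : star (@onb R X (mxtens_index (i1, i2))) = @onb R X (mxtens_index (i2, i1)).
  rewrite /onb /star /= /mx_onb /mx_star !mxtens_indexK /=.
  apply/matrixP => u v; rewrite trmxCE !mxE rmorphM /= conj_sqrtC_natr conjC_nat.
  by rewrite andbC.
by rewrite onb_ortho (can_eq (@mxtens_indexK _ _)) xpair_eqE andbC.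
Qed.

(** In operator form, [opstar T] sends [x] to [star (T (star x))]; [qev] and [qcoev] pair each index
    with its transpose only. *)
Lemma matrix_opstarE (T : 'M[C]_(qdim X)) a1 a2 b1 b2 :
  opstar T (mxtens_index (a1, a2)) (mxtens_index (b1, b2))
    = (T (mxtens_index (a2, a1)) (mxtens_index (b2, b1)))^*.
Proof.
have coevE : qcoev X = (qev X) ^t*.
  by rewrite /qev /qcoev trmx_mul map_mxM trmxCK.
rewrite opstarE (bigD1 (mxtens_index (b2, b1))) //= [X in _ + X]big1 ?addr0.
  rewrite (bigD1 (mxtens_index (a2, a1))) //= [X in _ + X]big1 ?addr0.
    by rewrite coevE trmxCE !matrix_qevE !eqxx conjC1 mul1r mulr1.
  move=> d; have [d1 d2] := mxtens_indexP d; rewrite coevE trmxCE !matrix_qevE.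
  rewrite (can_eq (@mxtens_indexK _ _)) xpair_eqE => /negPf ->.
  by rewrite conjC0 mulr0.
move=> p; have [p1 p2] := mxtens_indexP p; rewrite matrix_qevE.
rewrite (can_eq (@mxtens_indexK _ _)) xpair_eqE => ne.
rewrite big1 // => d _; rewrite [b1 == _]eq_sym [b2 == _]eq_sym andbC.
by rewrite (negPf ne) !mul0r.
Qed.

Lemma matrix_qmul_sum (F : 'I_(n.+1 * n.+1 * (n.+1 * n.+1)) -> C) a1 a2 :
  \sum_u qmul X (mxtens_index (a1, a2)) u * F u
  = sqrtC n.+1%:R
    * \sum_l F (mxtens_index (mxtens_index (a1, l), mxtens_index (l, a2))).
Proof.
transitivity (\sum_j1 \sum_j2 \sum_k1 \sum_k2
    sqrtC n.+1%:R * [&& a1 == j1, j2 == k1 & a2 == k2]%:R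
    * F (mxtens_index (mxtens_index (j1, j2), mxtens_index (k1, k2)))).
  rewrite sum_tens sum_tens; apply: eq_bigr => j1 _; apply: eq_bigr => j2 _.
  rewrite sum_tens; apply: eq_bigr => k1 _; apply: eq_bigr => k2 _.
  by rewrite matrix_qmulE.
rewrite (bigD1 a1) //= [X in _ + X]big1 ?addr0; last first.
  move=> j1 ne; rewrite big1 // => j2 _; rewrite big1 // => k1 _.
  by rewrite big1 // => k2 _; rewrite eq_sym (negPf ne) mulr0 mul0r.
rewrite mulr_sumr; apply: eq_bigr => l _.
rewrite (bigD1 l) //= [X in _ + X]big1 ?addr0; last first.
  move=> k1 ne; rewrite big1 // => k2 _.
  by rewrite [l == k1]eq_sym (negPf ne) andbF mulr0 mul0r.
rewrite (bigD1 a2) //= [X in _ + X]big1 ?addr0; last first.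
  by move=> k2 ne; rewrite [a2 == k2]eq_sym (negPf ne) !andbF mulr0 mul0r.
by rewrite !eqxx mulr1.
Qed.

(** [matrix_qmul_sum] applies once to [qmul] and, after conjugation, once to its adjoint. The two
    square roots leave [n + 1] against the factor [(n + 1)^2] from [delta]. *)
Lemma matrix_schurE (S T : 'M[C]_(qdim X)) a1 a2 b1 b2 :
  schur S T (mxtens_index (a1, a2)) (mxtens_index (b1, b2)) =
  n.+1%:R^-1 * \sum_k \sum_l
     S (mxtens_index (a1, l)) (mxtens_index (b1, k))
     * T (mxtens_index (l, a2)) (mxtens_index (k, b2)).
Proof.
rewrite /schur mxE mxE /delta /= rmorphXn /= rmorph_nat.
rewrite (eq_bigr (fun u => sqrtC n.+1%:R * (qmul X (mxtens_index (b1, b2)) u)^*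
    * \sum_l (S *t T) (mxtens_index (mxtens_index (a1, l), mxtens_index (l, a2))) u)).
  under eq_bigr do rewrite -mulrA.
  rewrite -mulr_sumr -[X in _ * (_ * X)]conjCK rmorph_sum /=.
  under eq_bigr do rewrite rmorphM /= conjCK.
  rewrite matrix_qmul_sum rmorphM /= conj_sqrtC_natr rmorph_sum /=.
  rewrite [X in _ * X]mulrA -expr2 sqrtCK mulrA expr2 invfM divfK ?pnatr_eq0 //.
  congr (_ * _); apply: eq_bigr => k _.
  by rewrite conjCK; apply: eq_bigr => l _; rewrite tensmxE.
by move=> u _; rewrite mxE matrix_qmul_sum trmxCE mulrAC.
Qed.

End MatrixAlgebra.

(** * The graph [G4] *)

Section G4.
Variable R : realType.
Local Notation C := R[i].
Local Notation X := (matrix_qset R 2).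
Local Notation G4 := (G4 R).

(** The 0/1 pattern of [G4], with output indices first. Taking naturals lets case analysis on the
    ordinals decide every identity by computation. *)
Definition G4_bit (a1 a2 b1 b2 : nat) : bool :=
  if b1 == b2 then (a1 == a2) && (a1 != b1) else (a1 == b2) && (a2 == b1).

Lemma G4E (a1 a2 b1 b2 : 'I_3) :
  G4 (mxtens_index (a1, a2)) (mxtens_index (b1, b2))
    = 3 / 2 * (G4_bit a1 a2 b1 b2)%:R.
Proof.
rewrite [LHS]matrix_opmxE /= G4_map_delta /G4_unit /G4_bit !val_eqE.
case: (eqVneq b1 b2) => [_|_]; rewrite mxE; last by rewrite mxE.
congr (_ * _); rewrite summxE.
have [ab|ab] := eqVneq a1 b1; rewrite ?andbT ?andbF.
  rewrite big1 // => k kb; rewrite mxE ab.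
  by rewrite eq_sym (negPf kb).
rewrite (bigD1 a1) //= big1 => [|k /andP[_ ka]].
  by rewrite mxE eqxx eq_sym addr0.
by rewrite mxE eq_sym (negPf ka).
Qed.

(** The count 2 explains the scalar [3/2]: one third of [(3/2)^2 * 2] is again [3/2]. *)
Lemma G4_bit_schur (a1 a2 b1 b2 : 'I_3) :
  (\sum_(k < 3) \sum_(l < 3) G4_bit a1 l b1 k * G4_bit l a2 k b2)%N
    = (2 * G4_bit a1 a2 b1 b2)%N.
Proof.
rewrite !big_ord_recl !big_ord0 /=.
by case: a1 a2 b1 b2 => [[|[|[|?]]] ?] [[|[|[|?]]] ?] [[|[|[|?]]] ?] [[|[|[|?]]] ?].
Qed.

(** The right side is the identity plus [3 E], with [E = iota iota^*] having nonzero entries [1/3];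
    scaling by [9/4] gives the constants of [G4_quadratic]. *)
Lemma G4_bit_sqr (a1 a2 b1 b2 : 'I_3) :
  (\sum_(k < 3) \sum_(l < 3) G4_bit a1 a2 k l * G4_bit k l b1 b2)%N
    = (((a1 == b1) && (a2 == b2)) + ((a1 == a2) && (b1 == b2)))%N.
Proof.
rewrite !big_ord_recl !big_ord0 /=.
by case: a1 a2 b1 b2 => [[|[|[|?]]] ?] [[|[|[|?]]] ?] [[|[|[|?]]] ?] [[|[|[|?]]] ?].
Qed.

Lemma G4_bit_diag (a1 a2 : 'I_3) :
  (\sum_(k < 3) \sum_(l < 3) G4_bit a1 a2 k l * (k == l))%N
    = (2 * (a1 == a2))%N.
Proof.
rewrite !big_ord_recl !big_ord0 /=.
by case: a1 a2 => [[|[|[|?]]] ?] [[|[|[|?]]] ?].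
Qed.

Lemma quantum_graph_G4 : quantum_graph G4.
Proof.
apply/matrixP => a b; have [a1 a2] := mxtens_indexP a.
have [b1 b2] := mxtens_indexP b.
rewrite matrix_schurE G4E.
under eq_bigr do under eq_bigr do rewrite !G4E mulrACA -natrM.
under eq_bigr do rewrite -mulr_sumr -natr_sum.
rewrite -mulr_sumr -natr_sum G4_bit_schur natrM.
by field.
Qed.

Lemma irreflexive_G4 : irreflexive_graph G4.
Proof.
(* Against the identity only [l = k] survives, and [G4] never joins matrix units sharing a column or
   a row. *)
have bit_l (x y z : 'I_3) : G4_bit x y z y = false.
  by case: x y z => [[|[|[|?]]] ?] [[|[|[|?]]] ?] [[|[|[|?]]] ?].
have bit_r (x y z : 'I_3) : G4_bit y x y z = false.
  by case: x y z => [[|[|[|?]]] ?] [[|[|[|?]]] ?] [[|[|[|?]]] ?].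
split; apply/matrixP => a b; have [a1 a2] := mxtens_indexP a;
  have [b1 b2] := mxtens_indexP b; rewrite matrix_schurE [RHS]mxE;
  rewrite big1 ?mulr0 // => k _; rewrite big1 // => l _;
  rewrite G4E [fun_of_matrix 1%:M _ _]mxE (can_eq (@mxtens_indexK _ _)) xpair_eqE.
- by have [->|_] := eqVneq l k; rewrite ?bit_l ?mulr0 ?mul0r.
- by have [->|_] := eqVneq l k; rewrite ?bit_r ?andbF !(mul0r, mulr0).
Qed.

Lemma real_G4 : real_graph G4.
Proof.
apply/matrixP => a b; have [a1 a2] := mxtens_indexP a.
have [b1 b2] := mxtens_indexP b; rewrite matrix_opstarE !G4E.
rewrite rmorphM fmorph_div !rmorph_nat /=; congr (_ * (_ _)%:R).
by case: a1 a2 b1 b2 {a b} => [[|[|[|?]]] ?] [[|[|[|?]]] ?] [[|[|[|?]]] ?] [[|[|[|?]]] ?].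
Qed.

Lemma undirected_G4 : undirected_graph G4.
Proof.
apply/matrixP => a b; have [a1 a2] := mxtens_indexP a.
have [b1 b2] := mxtens_indexP b; rewrite trmxCE !G4E.
rewrite rmorphM fmorph_div !rmorph_nat /=; congr (_ * (_ _)%:R).
by case: a1 a2 b1 b2 {a b} => [[|[|[|?]]] ?] [[|[|[|?]]] ?] [[|[|[|?]]] ?] [[|[|[|?]]] ?].
Qed.

Lemma G4_qunit : G4 *m qunit X = 3 *: qunit X.
Proof.
apply/matrixP => a o; have [a1 a2] := mxtens_indexP a.
rewrite {o}(ord1 o) [RHS]mxE matrix_qunitE mxE sum_tens.
under eq_bigr do under eq_bigr do
  rewrite G4E matrix_qunitE [_ / sqrtC _]mulrC mulrACA -natrM.
under eq_bigr do rewrite -mulr_sumr -natr_sum.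
rewrite -mulr_sumr -natr_sum G4_bit_diag natrM.
by set s := (sqrtC _)^-1; field.
Qed.

Lemma qunit_G4 : (qunit X) ^t* *m G4 = 3 *: (qunit X) ^t*.
Proof.
have := congr1 (fun M => M ^t*) G4_qunit.
rewrite trmx_mul map_mxM undirected_G4 => ->.
by apply/matrixP => i j; rewrite !mxE rmorphM rmorph_nat.
Qed.

Lemma G4_quadratic : G4 *m G4 + 0%:~R *: G4
  = (9 / 4)%:M + (27 / 4) *: (qunit X *m (qunit X) ^t*).
Proof.
apply/matrixP => a b; have [a1 a2] := mxtens_indexP a.
have [b1 b2] := mxtens_indexP b.
rewrite scale0r addr0 [RHS]mxE [X in _ = _ + X]mxE matrix_rank1E mxE sum_tens.
under eq_bigr do under eq_bigr do rewrite !G4E mulrACA -natrM.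
under eq_bigr do rewrite -mulr_sumr -natr_sum.
rewrite -mulr_sumr -natr_sum G4_bit_sqr natrD [X in _ = X + _]mxE.
by rewrite (can_eq (@mxtens_indexK _ _)) xpair_eqE -mulr_natr; field.
Qed.

(** The square has no linear term, so [lambda = mu]; with [J = 9 E], matching coefficients gives
    [9 mu = 27/4] and [k - mu = 9/4]. *)
Lemma strongly_regular_G4 : strongly_regular G4 3 (3 / 4) (3 / 4).
Proof.
have := G4_quadratic; rewrite scale0r addr0 /strongly_regular => ->.
rewrite /graph_compl /Jop /delta /= rmorphXn /= rmorph_nat.
move: (_ *m _) G4 => E T; apply/matrixP => i j; rewrite !mxE.
move: (T i j) (E i j) => t e.
by case: (i == j); rewrite ?mulr1n ?mulr0n; field.
Qed.

(** * The complement [G6], of degree [9 - 1 - 3 = 5] *)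

Local Notation G6 := (graph_compl G4).

Lemma delta2_matrix3 : (delta X ^+ 2)%:C = 9.
Proof. by rewrite /delta /= rmorphXn /= rmorph_nat -natrX. Qed.

Lemma G6_qunit : G6 *m qunit X = 5 *: qunit X.
Proof.
rewrite (graph_compl_qunit G4_qunit); congr (_ *: _).
by rewrite delta2_matrix3; ring.
Qed.

Lemma qunit_G6 : (qunit X) ^t* *m G6 = 5 *: (qunit X) ^t*.
Proof.
rewrite (qunit_graph_compl qunit_G4); congr (_ *: _).
by rewrite delta2_matrix3; ring.
Qed.

(** The constants are [9/4 - 1] and [81 - 54 + 27/4]. *)
Lemma G6_quadratic : G6 *m G6 + 2%:~R *: G6
  = (5 / 4)%:M + (135 / 4) *: (qunit X *m (qunit X) ^t*).
Proof.
have := G4_quadratic; rewrite scale0r addr0.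
move/(graph_compl_quadratic G4_qunit qunit_G4) => ->.
by congr (_%:M + _ *: _); rewrite ?delta2_matrix3; field.
Qed.

End G4.

Theorem mainTheorem5 (R : realType) :
  let G6 := graph_compl (G4 R) in
  [/\ quantum_graph (G4 R), irreflexive_graph (G4 R), real_graph (G4 R)
    & undirected_graph (G4 R)] /\
  (exists k lambda : R[i], strongly_regular (G4 R) k lambda (3 / 4)) /\
  (3 / 4 != 0 :> R[i]) /\
  (connected_graph (G4 R) /\ connected_graph G6) /\
  (~ qiso_to_classical (G4 R) /\ ~ qiso_to_classical G6).
Proof.
move=> G6.
have not_int (x : int) : (x == 9) || (x == 5) ->
    forall z : int, x%:~R / 4 <> z%:~R :> R[i].
  move=> x95 z /(congr1 ( *%R^~ 4)); rewrite divfK ?pnatr_eq0 //.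
  rewrite -[4]/(4%:~R) -rmorphM => /intr_inj E.
  by move: x95; rewrite E; lia.
split; first by split; [exact: quantum_graph_G4 | exact: irreflexive_G4
  | exact: real_G4 | exact: undirected_G4].
split; first by exists 3, (3 / 4); exact: strongly_regular_G4.
split; first by rewrite mulf_neq0 ?invr_eq0 ?pnatr_eq0.
split; split.
- apply: (connected_quadratic (@G4_qunit R) (@qunit_G4 R) (@G4_quadratic R)).
  rewrite mul0r addr0.
  (* Applying the relation to [iota] gives [k^2 + a k = q + c], so this quantity is just [c]. *)
  have -> : 3 ^+ 2 - 9 / 4 = 27 / 4 :> R[i] by field.
  by rewrite mulf_neq0 ?invr_eq0 ?pnatr_eq0.
- apply: (connected_quadratic (@G6_qunit R) (@qunit_G6 R) (@G6_quadratic R)).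
  have -> : 5 ^+ 2 + 2%:~R * 5 - 5 / 4 = 135 / 4 :> R[i] by field.
  by rewrite mulf_neq0 ?invr_eq0 ?pnatr_eq0.
- apply: (not_qiso_to_classical (@G4_quadratic R)).
  + exact: (not_int 9).
  (* Here [q + c = k^2 = 9], to be compared with the one-point values 0 and 1. *)
  + have -> : 9 / 4 + 27 / 4 = 9%:R :> R[i] by field.
    by apply/eqP; rewrite pnatr_eq0.
  + have -> : 9 / 4 + 27 / 4 = 9%:R :> R[i] by field.
    by apply/eqP; rewrite addr0 (eqr_nat _ 9 1).
- apply: (not_qiso_to_classical (@G6_quadratic R)).
  + exact: (not_int 5).
  (* Here [q + c = 25 + 10 = 35], against the one-point values 0 and 3. *)
  + have -> : 5 / 4 + 135 / 4 = 35%:R :> R[i] by field.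
    by apply/eqP; rewrite pnatr_eq0.
  + have -> : 5 / 4 + 135 / 4 = 35%:R :> R[i] by field.
    by apply/eqP; rewrite -[1 + _](natrD _ 1 2) (eqr_nat _ 35 3).
Qed.
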